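(* Let $q$ be an odd prime power. Let $B\subset\mathbb{P}^2$ be the Ballico-Hefez curve over $\mathbb{F}_q$, i.e. the image of $\Phi:\mathbb{P}^1\to\mathbb{P}^2$, $\Phi(s,t)=(s^{q+1},\,s^{q}t+st^{q},\,t^{q+1})$. Let $l_1,\dots,l_{q+1}$ be $q+1$ $\mathbb{F}_q$-lines in $\mathbb{P}^2$ that form an arc in the dual plane $\check{\mathbb{P}}^2(\mathbb{F}_q)$ (that is, no three of them are concurrent), and put $\mathcal{S}=\mathbb{P}^2(\mathbb{F}_q)\setminus\bigcup_{i<j}(l_i\cap l_j)$. Let $D$ be a conic over $\mathbb{F}_q$ in $\mathbb{P}^2$, and let $\mathcal{T}$ be the set of internal points of $D(\mathbb{F}_q)$ together with the points of $D(\mathbb{F}_q)$. Then the three subsets $B(\mathbb{F}_q)$, $\mathcal{S}$ and $\mathcal{T}$ of $\mathbb{P}^2(\mathbb{F}_q)$ are projectively equivalent over $\mathbb{F}_q$.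
   Context: $B(\mathbb{F}_q)$ is the set of points of $B$ in $\mathbb{P}^2(\mathbb{F}_q)$. An $\mathbb{F}_q$-line is a line of $\mathbb{P}^2$ defined over $\mathbb{F}_q$; $\check{\mathbb{P}}^2(\mathbb{F}_q)$ is the projective plane of $\mathbb{F}_q$-lines. A conic means an absolutely irreducible curve of degree $2$. For $q$ odd, each point of $\mathbb{P}^2(\mathbb{F}_q)\setminus D(\mathbb{F}_q)$ lies on either two or none of the tangent lines to $D$ at points of $D(\mathbb{F}_q)$; it is called external in the first case and internal in the second. Two subsets of $\mathbb{P}^2(\mathbb{F}_q)$ are projectively equivalent over $\mathbb{F}_q$ if some element of $\mathrm{PGL}_3(\mathbb{F}_q)$ maps one onto the other. *)

(* Defs.v *)
From HB Require Import structures.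
From mathcomp Require Import all_boot all_order all_algebra all_field.
From mathcomp Require Import mpoly.

Set Implicit Arguments.
Unset Strict Implicit.
Unset Printing Implicit Defensive.

Import GRing.Theory.
Local Open Scope ring_scope.

(* P^n(F) is the set of 1-dimensional subspaces of F^(n+1); a line of P^n     *)
(* defined over F is a 2-dimensional subspace.                                *)
Definition point (F : fieldType) (n : nat) :=
  {U : {vspace 'rV[F]_n.+1} | \dim U == 1%N}.

Definition line (F : fieldType) (n : nat) :=
  {U : {vspace 'rV[F]_n.+1} | \dim U == 2}.

Definition on_line (F : fieldType) (n : nat) (P : point F n) (l : line F n) :=
  (val P <= val l)%VS.

(* A nonzero vector spanning P.                                               *)
Definition coords (F : fieldType) (n : nat) (P : point F n) : 'rV[F]_n.+1 :=
  vpick (val P).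

Definition proj_equiv (F : fieldType) (n : nat) (X Y : point F n -> Prop) :=
  exists2 g : 'M[F]_n.+1, g \in unitmx &
    forall P' : point F n,
      Y P' <-> exists2 P : point F n, X P &
                 val P' = (linfun (mulmxr g) @: val P)%VS.

(* The F-rational points of a set C of points of P^n(K), where K is an        *)
(* extension of F through iota.                                               *)
Definition rational_points (F K : fieldType) (iota : {rmorphism F -> K})
    (n : nat) (C : point K n -> Prop) (P : point F n) : Prop :=
  exists2 P' : point K n, C P' & val P' = <[map_mx iota (coords P)]>%VS.

Definition Phi (K : fieldType) (q : nat) (s t : K) : 'rV[K]_3 :=
  \row_(i < 3) [:: s ^+ q.+1; s ^+ q * t + s * t ^+ q; t ^+ q.+1]`_i.

Definition ballico_hefez (K : fieldType) (q : nat) (P : point K 2) : Prop :=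
  exists s t : K, (s, t) != (0, 0) /\ val P = <[Phi q s t]>%VS.

Definition concurrent (F : fieldType) (l1 l2 l3 : line F 2) : Prop :=
  exists P : point F 2, [/\ on_line P l1, on_line P l2 & on_line P l3].

Definition dual_arc (F : fieldType) (m : nat) (l : 'I_m -> line F 2) : Prop :=
  injective l /\
  forall i j k : 'I_m, uniq [:: i; j; k] -> ~ concurrent (l i) (l j) (l k).

Definition arc_complement (F : fieldType) (m : nat) (l : 'I_m -> line F 2)
    (P : point F 2) : Prop :=
  ~ exists i j : 'I_m, [/\ (i < j)%N, on_line P (l i) & on_line P (l j)].

Definition irreducible_mpoly (K : fieldType) (n : nat) (p : {mpoly K[n]}) :=
  [/\ p != 0, p \isn't a GRing.unit &
      forall a b : {mpoly K[n]}, p = a * b ->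
        a \is a GRing.unit \/ b \is a GRing.unit].

(* Q is an equation of a conic over F; iota is an algebraic closure of F.     *)
Definition conic (F K : fieldType) (iota : {rmorphism F -> K})
    (Q : {mpoly F[3]}) : Prop :=
  Q \is 2.-homog /\ irreducible_mpoly (map_mpoly iota Q).

(* Independent of the choice of coordinates when Q is homogeneous; so is      *)
(* tangent_at below.                                                          *)
Definition on_conic (F : fieldType) (Q : {mpoly F[3]}) (P : point F 2) : Prop :=
  Q.@[coords P 0] = 0.

(* Since l has dimension 2, no line is tangent at a point where all the       *)
(* partial derivatives vanish.                                                *)
Definition tangent_at (F : fieldType) (Q : {mpoly F[3]}) (P : point F 2)
    (l : line F 2) : Prop :=
  on_conic Q P /\
  forall w : 'rV[F]_3,
    w \in val l <-> \sum_(i < 3) Q^`M(i).@[coords P 0] * w 0 i = 0.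

Definition internal (F : fieldType) (Q : {mpoly F[3]}) (P : point F 2) : Prop :=
  ~ on_conic Q P /\
  ~ exists (R : point F 2) (l : line F 2), tangent_at Q R l /\ on_line P l.

Definition internal_or_on (F : fieldType) (Q : {mpoly F[3]})
    (P : point F 2) : Prop :=
  internal Q P \/ on_conic Q P.

(* Main.v *)
Require Import Defs.
From mathcomp Require Import all_boot all_order all_algebra all_field.
From mathcomp Require Import mpoly ring.

(** Attach to a nonzero vector v = (a, b, c) the binary quadratic form
    a x^2 + b x y + c y^2, with discriminant b^2 - 4ac.  All three sets are, up
    to a linear change of coordinates, the set of v whose form does not have two
    distinct roots on the projective line over F, that is, whose discriminant is
    zero or a nonsquare ([no_two_roots]).  Any two sets with this property are
    projectively equivalent ([modelled_proj_equiv]).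

    - For the curve B no change of coordinates is needed: Phi (s, t) is the vector
      of elementary symmetric functions of the point (s : t) and its Frobenius
      conjugate.  A vector over F is of this form, up to a scalar, exactly when its
      two roots are exchanged by Frobenius or coincide
      ([ballico_hefez_modelled]).

    - For the lines, pass to their normal vectors, which form an arc of q + 1
      points.  By Segre's theorem ([segre]) they lie on a nonsingular conic.  Over
      a finite field of odd order a nonsingular conic has points, so it can be
      brought to the form y^2 = xz ([quadratic_normal_form]); its q + 1 points are
      the (1, t, t^2) and (0, 0, 1), so the normals are all of these.  A point v
      lies on the line with normal (1, t, t^2) when a + bt + ct^2 = 0, so the
      points on two of the lines are those with two distinct roots
      ([arc_complement_modelled]).

    - The conic D is brought to the form y^2 = 4xz.  The tangents through v
      correspond to the roots of a form with the discriminant of v, so the points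
      off D that lie on a tangent are those whose discriminant is a nonzero
      square ([conic_modelled]).  That D is nonsingular comes from absolute
      irreducibility: a singular ternary form is a binary form in two linear
      forms, hence a product over an algebraically closed field
      ([singular_quad_poly_reducible]).

    Segre's theorem is proved through Segre's lemma of tangents
    ([lemma_of_tangents]).  Each point of the arc is on exactly one line missing
    the rest of the arc.  Comparing the slopes of the lines through three points of
    the arc by Wilson's theorem gives a cyclic identity between their three
    tangent forms, which says that these forms can be rescaled so that the value of
    the form of P at R equals the value of the form of R at P.  The symmetric
    values on a basis define a symmetric matrix A such that every point P of the
    arc has tangent form P A, and P lies on its own tangent, so the quadratic form
    of A vanishes on the arc. *)
Set Implicit Arguments.
Unset Strict Implicit.
Unset Printing Implicit Defensive.

Import GRing.Theory.
Local Open Scope ring_scope.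

(** * Vectors with three coordinates *)

Lemma sum_ord3 (V : nmodType) (f : 'I_3 -> V) :
  \sum_i f i = f 0 + f 1 + f 2.
Proof.
rewrite !big_ord_recl big_ord0 addr0 addrA.
by congr (f _ + f _ + f _); apply: val_inj.
Qed.

Lemma ord3P (P : 'I_3 -> Prop) : P 0 -> P 1 -> P 2 -> forall i, P i.
Proof.
move=> P0 P1 P2 [[|[|[|//]]] ltn3].
- by rewrite (_ : Ordinal _ = 0) //; apply: val_inj.
- by rewrite (_ : Ordinal _ = 1) //; apply: val_inj.
- by rewrite (_ : Ordinal _ = 2) //; apply: val_inj.
Qed.

Definition dot (F : fieldType) (u v : 'rV[F]_3) : F := (u *m v^T) 0 0.

Definition vec3 (F : fieldType) (a b c : F) : 'rV[F]_3 :=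
  \row_(i < 3) [:: a; b; c]`_i.

Definition rows3 (F : fieldType) (u v w : 'rV[F]_3) : 'M[F]_3 :=
  \matrix_(i < 3) [:: u; v; w]`_i.

Definition det3 (F : fieldType) (u v w : 'rV[F]_3) : F := \det (rows3 u v w).

Section Coordinates.
Variable F : fieldType.
Implicit Types u v w : 'rV[F]_3.

Lemma rV3P u v : u 0 0 = v 0 0 -> u 0 1 = v 0 1 -> u 0 2 = v 0 2 -> u = v.
Proof. by move=> e0 e1 e2; apply/rowP=> i; elim/ord3P: i. Qed.

Lemma dotE u v : dot u v = u 0 0 * v 0 0 + u 0 1 * v 0 1 + u 0 2 * v 0 2.
Proof. by rewrite /dot mxE sum_ord3 !mxE. Qed.

Lemma dotC u v : dot u v = dot v u.
Proof. by rewrite !dotE; ring. Qed.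

Lemma dotDl u v w : dot (u + v) w = dot u w + dot v w.
Proof. by rewrite /dot mulmxDl mxE. Qed.

Lemma dotZl a u w : dot (a *: u) w = a * dot u w.
Proof. by rewrite /dot -scalemxAl mxE. Qed.

Lemma dotDr u v w : dot w (u + v) = dot w u + dot w v.
Proof. by rewrite dotC dotDl !(dotC w). Qed.

Lemma dotZr a u w : dot w (a *: u) = a * dot w u.
Proof. by rewrite dotC dotZl dotC. Qed.

Lemma dot_mulmxl A u v : dot (u *m A) v = dot u (v *m A^T).
Proof. by rewrite /dot trmx_mul trmxK mulmxA. Qed.

Lemma dot_sym A u v : A^T = A -> dot (u *m A) v = dot (v *m A) u.
Proof. by move=> symA; rewrite dot_mulmxl symA dotC. Qed.

Lemma row_mulmx_tr u v : (u *m v^T == 0) = (dot u v == 0).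
Proof.
rewrite /dot; apply/eqP/eqP=> [->|uv0]; first by rewrite mxE.
by apply/matrixP=> i j; rewrite !ord1 uv0 mxE.
Qed.

Lemma det3E u v w :
  det3 u v w = u 0 0 * (v 0 1 * w 0 2 - v 0 2 * w 0 1)
             - u 0 1 * (v 0 0 * w 0 2 - v 0 2 * w 0 0)
             + u 0 2 * (v 0 0 * w 0 1 - v 0 1 * w 0 0).
Proof.
rewrite /det3 (expand_det_row _ 0) sum_ord3 /cofactor !(expand_det_row _ 0).
rewrite !big_ord_recl !big_ord0 /cofactor !det_mx11 !mxE /=.
pose v' k := v 0 (inord k); pose w' k := w 0 (inord k).
have ev i : v 0 i = v' i by rewrite /v' inord_val.
have ew i : w 0 i = w' i by rewrite /w' inord_val.
rewrite !ev !ew /= /bump /=; ring.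
Qed.

Lemma row_rows3 u v w i : row i (rows3 u v w) = [:: u; v; w]`_i.
Proof. exact: rowK. Qed.

(** Two linear conditions on three unknowns. *)
Lemma orthogonal_exists u v :
  exists2 n, n != 0 & dot n u = 0 /\ dot n v = 0.
Proof.
have /rowV0Pn[n n_ker n_neq0] : kermx (row_mx u^T v^T) != 0.
  rewrite kermx_eq0 /row_free; apply/negP=> /eqP rk3.
  by have := rank_leq_col (row_mx u^T v^T); rewrite rk3.
exists n => //; move: n_ker => /sub_kermxP.
rewrite mul_mx_row => /eqP; rewrite row_mx_eq0 !row_mulmx_tr.
by case/andP=> /eqP-> /eqP->.
Qed.

Lemma mul_rows3_tr n u v w :
  n *m (rows3 u v w)^T = vec3 (dot n u) (dot n v) (dot n w).
Proof.
by apply: rV3P; rewrite mxE sum_ord3 !mxE /= dotE.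
Qed.

Lemma det3_eq0 u v w : det3 u v w = 0 ->
  exists2 n, n != 0 & [/\ dot n u = 0, dot n v = 0 & dot n w = 0].
Proof.
move/eqP; rewrite /det3 -det_tr => /det0P[n n_neq0].
rewrite mul_rows3_tr => e; exists n => //.
split.
- by have := congr1 (fun m : 'rV_3 => m 0 0) e; rewrite !mxE /=.
- by have := congr1 (fun m : 'rV_3 => m 0 1) e; rewrite /vec3 !mxE.
- by have := congr1 (fun m : 'rV_3 => m 0 2) e; rewrite /vec3 !mxE.
Qed.

End Coordinates.

(** * Points and lines through coordinate vectors *)

Section PointsLines.
Variable F : fieldType.

Lemma coords_neq0 n (P : point F n) : coords P != 0.
Proof. by rewrite vpick0 -dimv_eq0 (eqP (valP P)). Qed.

Lemma point_coords n (P : point F n) : val P = <[coords P]>%VS.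
Proof.
apply/esym/eqP; rewrite eqEdim -memvE memv_pick.
by rewrite (eqP (valP P)) dim_vline coords_neq0.
Qed.

Lemma coords_line n (P : point F n) v : v != 0 -> val P = <[v]>%VS ->
  exists2 a, a != 0 & coords P = a *: v.
Proof.
move=> v_neq0 eP; have: coords P \in <[v]>%VS by rewrite -eP memv_pick.
case/vlineP=> a ea; exists a => //.
by apply: contraNneq (coords_neq0 P) => a0; rewrite ea a0 scale0r.
Qed.

Lemma point_exists n (v : 'rV[F]_n.+1) : v != 0 ->
  exists P : point F n, val P = <[v]>%VS.
Proof.
move=> v_neq0; have dv : \dim <[v]> == 1%N by rewrite dim_vline v_neq0.
by exists (exist _ <[v]>%VS dv).
Qed.

Lemma on_line_coords (P : point F 2) l : on_line P l = (coords P \in val l).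
Proof. by rewrite /on_line point_coords memvE. Qed.

Definition dot_fun (n : 'rV[F]_3) : 'Hom('rV[F]_3, 'rV[F]_1) :=
  linfun (mulmxr n^T).

Definition perp (n : 'rV[F]_3) : {vspace 'rV[F]_3} := lker (dot_fun n).

Lemma mem_perp n w : (w \in perp n) = (dot w n == 0).
Proof. by rewrite memv_ker lfunE /= row_mulmx_tr. Qed.

Lemma dim_perp n : n != 0 -> \dim (perp n) = 2.
Proof.
move=> n_neq0; have := limg_ker_dim (dot_fun n) fullv.
rewrite dimvf /dim /= capfv -/(perp n) => dim_sum.
suff dim1: \dim (limg (dot_fun n)) = 1%N.
  by move: dim_sum; rewrite dim1 addn1; case.
apply/eqP; rewrite eqn_leq; apply/andP; split.
  by apply: leq_trans (dimvS (subvf _)) _; rewrite dimvf.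
rewrite lt0n dimv_eq0; apply: contraNneq n_neq0 => img0.
suff n0 i : n 0 i = 0 by apply/eqP/rowP=> i; rewrite n0 mxE.
have : dot_fun n (delta_mx 0 i) \in limg (dot_fun n) by rewrite memv_img ?memvf.
rewrite img0 memv0 -memv_ker -/(perp n) mem_perp /dot -rowE.
by rewrite !mxE => /eqP.
Qed.

Lemma line_normal (l : line F 2) :
  exists2 n, n != 0 & forall w, (w \in val l) = (dot w n == 0).
Proof.
have [n n_neq0 [n1 n2]] := orthogonal_exists (vbasis (val l))`_0 (vbasis (val l))`_1.
exists n => // w; rewrite -mem_perp; suff -> : val l = perp n by [].
apply/eqP.
rewrite eqEdim dim_perp // (eqP (valP l)) andbT.
rewrite -[X in (X <= _)%VS](span_basis (vbasisP _)); apply/span_subvP=> b.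
case/(nthP 0)=> i lti <-; rewrite size_tuple (eqP (valP l)) in lti.
rewrite mem_perp dotC; case: i lti => [|[|//]] _; last by rewrite n2.
by rewrite n1.
Qed.

Lemma line_of_normal (n : 'rV[F]_3) : n != 0 ->
  exists l : line F 2, forall w, (w \in val l) = (dot w n == 0).
Proof.
move=> n_neq0; have dn : \dim (perp n) == 2 by rewrite dim_perp.
by exists (exist _ (perp n) dn) => w; rewrite mem_perp.
Qed.

End PointsLines.

(** * Projective equivalence through a model set of vectors *)

Definition scale_inv (F : fieldType) (n : nat) (W : 'rV[F]_n.+1 -> Prop) :=
  forall a v, a != 0 -> W (a *: v) <-> W v.

(** X is the inverse image of the point set described by W under the
    projectivity of h. *)
Definition modelled (F : fieldType) (n : nat) (W : 'rV[F]_n.+1 -> Prop)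
    (X : point F n -> Prop) (h : 'M[F]_n.+1) :=
  h \in unitmx /\ forall P, X P <-> W (coords P *m h).

(** If h carries X to the model and k carries Y to it, then h k^-1 carries X
    to Y. *)
Lemma modelled_proj_equiv (F : fieldType) (n : nat) (W : 'rV[F]_n.+1 -> Prop)
    (X Y : point F n -> Prop) (h k : 'M[F]_n.+1) :
  scale_inv W -> modelled W X h -> modelled W Y k -> proj_equiv X Y.
Proof.
move=> Winv [h_unit Xh] [k_unit Yk]; set g := h *m invmx k.
have g_unit : g \in unitmx by rewrite unitmx_mul h_unit unitmx_inv.
have gk : g *m k = h by rewrite /g mulmxKV.
have img (P : point F n) : (linfun (mulmxr g) @: val P = <[coords P *m g]>)%VS.
  by rewrite point_coords limg_line lfunE.
have nz (v : 'rV[F]_n.+1) : v != 0 -> v *m g != 0.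
  apply: contraNneq => /(congr1 (mulmxr (invmx g))) /=.
  by rewrite mulmxK // mul0mx => ->.
exists g => // P'; rewrite Yk; split=> [WP'|[P XP eP']].
  have [|P eP] := @point_exists F n (coords P' *m invmx g).
    apply: contraNneq (coords_neq0 P') => /(congr1 (mulmxr g)) /=.
    by rewrite mulmxKV // mul0mx => ->.
  exists P; last by rewrite eP limg_line lfunE /= mulmxKV // point_coords.
  rewrite Xh.
  have [|a a_neq0 ->] := coords_line _ eP.
    apply: contraNneq (coords_neq0 P') => /(congr1 (mulmxr g)) /=.
    by rewrite mulmxKV // mul0mx => ->.
  by rewrite -scalemxAl Winv // -gk mulmxA mulmxKV.
have [a a_neq0 ->] := coords_line (nz _ (coords_neq0 P)) (etrans eP' (img P)).
by rewrite -!scalemxAl Winv // -mulmxA gk -Xh.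
Qed.

(** * Ternary quadratic forms over a finite field of odd order *)

(** Translation by 1 permutes F, so adding up all elements gives q * 1 = 0, which
    is 1 when q is odd and 2 = 0. *)
Lemma odd_card_two_neq0 (F : finFieldType) : odd #|F| -> (2 : F) != 0.
Proof.
move=> oddF; apply/eqP=> two0.
have card0 : #|F|%:R = 0 :> F.
  have : \sum_(x : F) x = \sum_(x : F) (x + 1).
    by rewrite [LHS](reindex_inj (addIr (1 : F))).
  by rewrite big_split /= sumr_const -[LHS]addr0 => /addrI /esym.
move: card0; rewrite -(odd_double_half #|F|) oddF -mul2n natrD natrM two0 mul0r.
by rewrite addr0 => /eqP; rewrite oner_eq0.
Qed.

Section QuadraticForms.
Variable F : finFieldType.
Hypothesis oddF : odd #|F|.
Let two_neq0 : (2 : F) != 0 := odd_card_two_neq0 oddF.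
Implicit Types (A : 'M[F]_3) (u v w : 'rV[F]_3).

(** Each value is taken at most twice, at x and - x. *)
Lemma card_quadratic_image (a c : F) : a != 0 ->
  (#|F| <= #|[set a * x ^+ 2 + c | x : F]%R| * 2)%N.
Proof.
move=> a_neq0; set f := fun x : F => a * x ^+ 2 + c.
rewrite -[X in (X <= _)%N]sum1_card (partition_big f (mem (f @: F))) /=; last first.
  by move=> x _; apply/imsetP; exists x.
rewrite -sum_nat_const; apply: leq_sum => _ /imsetP[x _ ->].
rewrite sum1_card; apply: leq_trans (_ : #|[set x; - x]| <= 2)%N.
  apply/subset_leq_card/subsetP=> y; rewrite !inE /f => /eqP/addIr/(mulfI a_neq0).
  by move/eqP; rewrite eqf_sqr.
by rewrite cards2; case: (_ != _).
Qed.

(** The values of a x^2 and those of c - b y^2 each fill more than half of F, so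
    they meet. *)
Lemma binary_form_surjective (a b c : F) : a != 0 -> b != 0 ->
  exists x y, a * x ^+ 2 + b * y ^+ 2 = c.
Proof.
move=> a_neq0 b_neq0.
set X := [set a * x ^+ 2 + 0 | x : F]; set Y := [set - b * y ^+ 2 + c | y : F].
have cX : (#|F| <= #|X| * 2)%N by apply: card_quadratic_image.
have cY : (#|F| <= #|Y| * 2)%N by apply: card_quadratic_image; rewrite oppr_eq0.
have /card_gt0P[z] : (0 < #|X :&: Y|)%N.
  have := cardsUI X Y; have := max_card (mem (X :|: Y)).
  have eF : #|F| = #|F|./2.*2.+1 by rewrite -[LHS]odd_double_half oddF.
  move: cX cY; rewrite eF !muln2 !ltn_double => cX cY cU cI; rewrite lt0n.
  apply/eqP=> cI0; move: cI; rewrite cI0 addn0 => cI.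
  have := leq_add cX cY; rewrite -cI => /leq_trans/(_ cU).
  by rewrite addSn addnS addnn ltnn.
rewrite inE => /andP[/imsetP[x _ ->] /imsetP[y _ exy]].
by exists x, y; rewrite -[LHS]addr0 addrAC exy; ring.
Qed.

(** Choose u, v, w orthogonal for the form of A.  Unless one of them is isotropic,
    the form is diagonal on them and - q(w) is represented by the binary form of u
    and v. *)
Lemma isotropic_exists A : A^T = A ->
  exists2 v, v != 0 & dot (v *m A) v = 0.
Proof.
move=> symA; pose u := vec3 (1 : F) 0 0.
have u_neq0 : u != 0.
  by apply/eqP=> /rowP/(_ 0)/eqP; rewrite !mxE /= oner_eq0.
have [|qu] := eqVneq (dot (u *m A) u) 0; first by exists u.
have [v v_neq0 [vu _]] := orthogonal_exists (u *m A) (u *m A).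
have [|qv] := eqVneq (dot (v *m A) v) 0; first by exists v.
have [w w_neq0 [wu wv]] := orthogonal_exists (u *m A) (v *m A).
have [|qw] := eqVneq (dot (w *m A) w) 0; first by exists w.
have [x [y exy]] := binary_form_surjective (- dot (w *m A) w) qu qv.
have uv : dot (u *m A) v = 0 by rewrite dotC.
have uw : dot (u *m A) w = 0 by rewrite dotC.
have vw : dot (v *m A) w = 0 by rewrite dotC.
have vu' : dot (v *m A) u = 0 by rewrite dot_sym.
have wu' : dot (w *m A) u = 0 by rewrite dot_sym.
have wv' : dot (w *m A) v = 0 by rewrite dot_sym.
exists (x *: u + y *: v + w).
  (* Pairing the combination with w for the form of A leaves q(w). *)
  apply: contraNneq qw => /(congr1 (dot (w *m A))).
  rewrite !dotDr !dotZr wu' wv' !mulr0 !add0r => ->.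
  by rewrite -(scale0r 0) dotZr mul0r.
rewrite !mulmxDl -!scalemxAl !dotDl !dotDr !dotZl !dotZr.
rewrite uv uw vw vu' wu' wv' !mulr0 !addr0 !add0r.
by rewrite -[dot (w *m A) w]opprK -exy; ring.
Qed.

Lemma mul_rows3 n u v w :
  n *m rows3 u v w = n 0 0 *: u + n 0 1 *: v + n 0 2 *: w.
Proof. by rewrite mulmx_sum_row sum_ord3 !row_rows3. Qed.

(** An isotropic e pairs nontrivially with some w, and moving w along e changes
    q(w) by any amount without changing its pairing with e. *)
Lemma hyperbolic_pair A : A^T = A -> A \in unitmx ->
  exists e w, [/\ dot (e *m A) e = 0, dot (w *m A) w = 0 & dot (e *m A) w != 0].
Proof.
move=> symA unitA; have [e e_neq0 qe] := isotropic_exists symA.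
have [i ewi] : exists i, (e *m A) 0 i != 0.
  apply/existsP; apply: contraNT e_neq0 => /existsPn all0.
  rewrite -[e](mulmxK unitA) (_ : e *m A = 0) ?mul0mx //.
  by apply/rowP=> i; rewrite [RHS]mxE; apply/eqP; have := all0 i; rewrite negbK.
pose w : 'rV[F]_3 := delta_mx 0 i.
have ew : dot (e *m A) w != 0 by rewrite dotC /dot -rowE 2!mxE.
have we : dot (w *m A) e = dot (e *m A) w by rewrite dot_sym.
exists e, (w + (- (dot (w *m A) w / (2 * dot (e *m A) w))) *: e).
rewrite mulmxDl -!scalemxAl !dotDl !dotDr !dotZl !dotZr qe we.
split=> //; last by rewrite mulr0 addr0.
by field; rewrite two_neq0 ew.
Qed.

(** A hyperbolic pair e, w and a vector u orthogonal to both form a basis in which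
    the form is q(u) y^2 + 2 b(e, w) xz; rescaling e gives the ratio of the two
    coefficients any prescribed nonzero value. *)
Lemma quadratic_normal_form A (r : F) : r != 0 -> A^T = A -> A \in unitmx ->
  exists2 g : 'M[F]_3, g \in unitmx &
    exists2 k : F, k != 0 &
      forall n : 'rV[F]_3, dot (n *m g *m A) (n *m g) =
        k * (n 0 1 ^+ 2 - r * n 0 0 * n 0 2).
Proof.
move=> r_neq0 symA unitA; have [e [w [qe qw ew]]] := hyperbolic_pair symA unitA.
have [u u_neq0 [ue' uw']] := orthogonal_exists (e *m A) (w *m A).
have eu : dot (e *m A) u = 0 by rewrite dotC.
have wu : dot (w *m A) u = 0 by rewrite dotC.
have ue : dot (u *m A) e = 0 by rewrite dot_sym.
have uw : dot (u *m A) w = 0 by rewrite dot_sym.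
have we : dot (w *m A) e = dot (e *m A) w by rewrite dot_sym.
have basis s : s != 0 -> rows3 (s *: e) u w \in unitmx.
  move=> s_neq0; rewrite unitmxE unitfE; apply/negP=> /det0P[n n_neq0].
  rewrite mul_rows3 => en; case/eqP: n_neq0.
  have n2 : n 0 2 = 0.
    have /eqP := congr1 (dot (e *m A)) en.
    rewrite !dotDr !dotZr qe eu !mulr0 !add0r -(scale0r 0) dotZr mul0r.
    by rewrite mulf_eq0 (negPf ew) orbF => /eqP.
  have n0 : n 0 0 = 0.
    have /eqP := congr1 (dot (w *m A)) en.
    rewrite !dotDr !dotZr qw wu we !mulr0 !addr0 -(scale0r 0) dotZr mul0r.
    by rewrite !mulf_eq0 (negPf ew) (negPf s_neq0) !orbF => /eqP.
  have n1 : n 0 1 = 0.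
    move/eqP: en; rewrite n0 n2 !scale0r add0r addr0 scaler_eq0 (negPf u_neq0).
    by rewrite orbF => /eqP.
  by apply: rV3P; rewrite ?n0 ?n1 ?n2 mxE.
(* An isotropic u would be orthogonal to the whole basis. *)
have qu : dot (u *m A) u != 0.
  apply: contra_neq u_neq0 => qu; have := basis 1 (oner_neq0 _).
  rewrite scale1r -unitmx_tr => unitM.
  rewrite -[u](mulmxK unitA) -[u *m A](mulmxK unitM) mul_rows3_tr ue uw qu.
  suff -> : vec3 (0 : F) 0 0 = 0 by rewrite !mul0mx.
  by apply: rV3P; rewrite !mxE.
(* This s solves 2 s b(e, w) = - r q(u). *)
pose s := - (r * dot (u *m A) u) / (2 * dot (e *m A) w).
have s_neq0 : s != 0.
  by rewrite !mulf_neq0 ?invr_neq0 ?oppr_eq0 ?mulf_neq0.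
exists (rows3 (s *: e) u w); first exact: basis.
exists (dot (u *m A) u) => // n; rewrite mul_rows3.
rewrite !mulmxDl -!scalemxAl !dotDl !dotDr !dotZl !dotZr.
rewrite qe qw eu wu ue uw we /s.
by field; rewrite two_neq0 ew.
Qed.

End QuadraticForms.

(** * Arcs of maximal size lie on conics *)

Definition cross (F : fieldType) (u v : 'rV[F]_3) : 'rV[F]_3 :=
  vec3 (u 0 1 * v 0 2 - u 0 2 * v 0 1)
       (u 0 2 * v 0 0 - u 0 0 * v 0 2)
       (u 0 0 * v 0 1 - u 0 1 * v 0 0).

Section DetIdentities.
Variable F : fieldType.
Implicit Types u v w p f : 'rV[F]_3.

Lemma dot_cross p u v : dot p (cross u v) = det3 u v p.
Proof. by rewrite dotE det3E /cross !mxE /=; ring. Qed.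

Lemma det3_rot u v w : det3 w u v = det3 u v w.
Proof. by rewrite !det3E; ring. Qed.

Lemma det3_alt u v : det3 u v v = 0.
Proof. by rewrite det3E; ring. Qed.

Lemma cramer3 u v w p f :
  det3 u v w * dot p f =
    det3 v w p * dot u f + det3 w u p * dot v f + det3 u v p * dot w f.
Proof. by rewrite !det3E !dotE; ring. Qed.

(** Two points p, p' have the same slope, seen from u, exactly when u, p, p' are
    collinear. *)
Lemma pluecker3 u v w p p' :
  det3 w u p * det3 u v p' - det3 w u p' * det3 u v p =
    det3 u v w * det3 u p p'.
Proof. by rewrite !det3E; ring. Qed.

End DetIdentities.

(** Wilson's theorem for finite fields: it is the constant term of
    X^(q-1) - 1 = prod_(x != 0) (X - x). *)
Lemma prod_nonzero (F : finFieldType) : \prod_(x : F | x != 0) x = -1.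
Proof.
have := finField_genPoly F; have := finNzRing_gt1 F.
case: #|F| => [|[|m]] // _; rewrite (bigD1 0) //= subr0 exprS.
rewrite -[X in _ - X]mulr1 -mulrBr => /(mulfI (negbT (polyX_eq0 _))).
move/(congr1 (horner^~ 0)); rewrite horner_prod !hornerE expr0n /= sub0r => ->.
rewrite (reindex_inj (@oppr_inj F)) /=; apply: eq_big => x.
  by rewrite oppr_eq0.
by rewrite !hornerE.
Qed.

Section Segre.
Variables (F : finFieldType) (I : finType) (n : I -> 'rV[F]_3).
Hypothesis oddF : odd #|F|.
Hypothesis cardI : #|I| = #|F|.+1.
Hypothesis arc : forall i j k, uniq [:: i; j; k] -> det3 (n i) (n j) (n k) != 0.

Definition tangent_form (i : I) (f : 'rV[F]_3) :=
  dot (n i) f = 0 /\ forall j, j != i -> dot (n j) f != 0.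

Section Slopes.
Variables i j k : I.
Hypothesis uijk : uniq [:: i; j; k].

(** The position of the line joining the points i and p in the pencil of lines
    through the point i, the lines to k and j being at 0 and infinity. *)
Definition slope (p : I) : F :=
  det3 (n k) (n i) (n p) / det3 (n i) (n j) (n p).

Let others := [pred p | p \notin [:: i; j; k]].

Let dki p : p \notin [:: i; j; k] -> det3 (n k) (n i) (n p) != 0.
Proof.
move: uijk; rewrite /= !inE !negb_or !andbT => /andP[/andP[ij ik] jk].
case/and3P=> pi pj pk; apply: arc; rewrite /= !inE !negb_or andbT.
by rewrite [k == i]eq_sym [k == p]eq_sym [i == p]eq_sym ik pk pi.
Qed.

Let dij p : p \notin [:: i; j; k] -> det3 (n i) (n j) (n p) != 0.
Proof.
move: uijk; rewrite /= !inE !negb_or !andbT => /andP[/andP[ij ik] jk].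
case/and3P=> pi pj pk; apply: arc; rewrite /= !inE !negb_or andbT.
by rewrite [j == p]eq_sym [i == p]eq_sym ij pj pi.
Qed.

Lemma slope_inj : {in others &, injective slope}.
Proof.
move=> p p' op op' /eqP; rewrite eqr_div ?dij // -subr_eq0 pluecker3.
rewrite mulf_eq0 (negPf (arc uijk)) /=; apply: contraTeq => pp'; apply: arc.
move: op op'; rewrite !inE !negb_or => /and3P[pi _ _] /and3P[pi' _ _].
by rewrite /= !inE !negb_or [i == p]eq_sym [i == p']eq_sym pi pi' pp'.
Qed.

Let slopes := [set slope p | p in others].

(** The q - 2 other points of the arc have distinct nonzero slopes, so a single
    nonzero slope is left for the tangent. *)
Lemma card_slopes : #|slopes|.+2 = #|F|.
Proof.
rewrite card_in_imset; last exact: slope_inj.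
apply/eqP; rewrite -(eqn_add2r 1) !addn1 -cardI -(cardC (mem [:: i; j; k])).
by rewrite (card_uniqP uijk).
Qed.

Lemma zero_notin_slopes : 0 \notin slopes.
Proof.
apply/imsetP=> -[p op /esym/eqP]; rewrite mulf_eq0 invr_eq0.
by rewrite (negPf (dki op)) (negPf (dij op)).
Qed.

Lemma missing_slope_exists :
  exists2 c : F, c != 0 & forall p, p \in others -> slope p != c.
Proof.
have /subsetPn[c _ nc] : ~~ ([set: F] \subset 0 |: slopes).
  apply/negP=> /subset_leq_card; rewrite cardsT cardsU1 zero_notin_slopes.
  by rewrite -card_slopes /= add1n ltnn.
move: nc; rewrite !inE negb_or => /andP[c_neq0 nc]; exists c => // p op.
by apply: contraNneq nc => <-; apply: imset_f.
Qed.

Lemma missing_slope_prod (c : F) : c != 0 ->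
    (forall p, p \in others -> slope p != c) ->
  c * \prod_(p in others) slope p = -1.
Proof.
move=> c_neq0 cP.
have nc : c \notin slopes.
  by apply/imsetP=> -[p op ec]; have := cP p op; rewrite -ec eqxx.
rewrite -(big_imset id slope_inj) /= -/slopes -big_setU1 //= -prod_nonzero.
apply: eq_bigl => x; suff -> : c |: slopes = ~: [set 0] by rewrite !inE.
apply/eqP; rewrite eqEcard; apply/andP; split.
  apply/subsetP=> y; rewrite !inE => /orP[/eqP-> // | ys].
  by apply: contraNneq zero_notin_slopes => <-.
by rewrite cardsC1 cardsU1 nc -card_slopes.
Qed.

Lemma tangent_form_exists_at : exists f, tangent_form i f.
Proof.
have [c c_neq0 cP] := missing_slope_exists.
exists (cross (n k) (n i) + (- c) *: cross (n i) (n j)).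
have fE p : dot (n p) (cross (n k) (n i) + (- c) *: cross (n i) (n j)) =
    det3 (n k) (n i) (n p) - c * det3 (n i) (n j) (n p).
  by rewrite dotDr dotZr !dot_cross mulNr.
split=> [|p pi]; rewrite fE.
  by rewrite !det3E; ring.
have [->|pj] := eqVneq p j.
  by rewrite det3_alt mulr0 subr0 det3_rot arc.
have [->|pk] := eqVneq p k.
  by rewrite det3_rot det3_alt sub0r oppr_eq0 mulf_neq0 ?arc.
have op : p \notin [:: i; j; k] by rewrite !inE !negb_or pi pj pk.
have := cP p op; rewrite /slope; apply: contra_neq => /eqP.
by rewrite subr_eq0 => /eqP->; rewrite mulfK ?dij.
Qed.

(** The slope of the tangent is - f(k) / f(j), and by Wilson's theorem its product
    with the slopes of the secants is - 1. *)
Lemma tangent_form_product f : tangent_form i f ->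
  dot (n k) f * \prod_(p in others) det3 (n k) (n i) (n p) =
  dot (n j) f * \prod_(p in others) det3 (n i) (n j) (n p).
Proof.
case=> fi f_neq0; move: (uijk); rewrite /= !inE !negb_or !andbT.
case/andP=> /andP[ij ik] jk.
have fj : dot (n j) f != 0 by rewrite f_neq0 // eq_sym.
have fk : dot (n k) f != 0 by rewrite f_neq0 // eq_sym.
have prodN1 : - (dot (n k) f / dot (n j) f) * \prod_(p in others) slope p = -1.
  apply: missing_slope_prod => [|p op].
    by rewrite oppr_eq0 mulf_neq0 ?invr_eq0.
  have pi : p != i by move: op; rewrite !inE negb_or => /andP[].
  apply: contraNneq (f_neq0 p pi) => sp.
  apply/eqP/(mulfI (arc uijk)); rewrite mulr0 cramer3 fi mulr0 add0r.
  have -> : det3 (n k) (n i) (n p) = slope p * det3 (n i) (n j) (n p).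
    by rewrite mulfVK ?dij.
  by rewrite sp; field.
have nz : \prod_(p in others) det3 (n i) (n j) (n p) != 0.
  by apply/prodf_neq0=> p; apply: dij.
move: prodN1; rewrite prodf_div => /eqP; rewrite mulNr eqr_opp => /eqP prod1.
rewrite -[RHS]mul1r -[X in _ = X * _]prod1.
by field; rewrite nz fj.
Qed.

End Slopes.

(** Multiply the product formulas at the three points: each of the three products
    of determinants occurs once on either side and cancels. *)
Lemma lemma_of_tangents i j k f g h : uniq [:: i; j; k] ->
    tangent_form i f -> tangent_form j g -> tangent_form k h ->
  dot (n k) f * dot (n i) g * dot (n j) h =
  dot (n j) f * dot (n k) g * dot (n i) h.
Proof.
move=> uijk ft gt ht.
have ujki : uniq [:: j; k; i] by rewrite -(rot_uniq 1) in uijk.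
have ukij : uniq [:: k; i; j] by rewrite -(rot_uniq 1) in ujki.
have := tangent_form_product uijk ft.
have := tangent_form_product ujki gt; have := tangent_form_product ukij ht.
have rjki : [pred p | p \notin [:: j; k; i]] =i [pred p | p \notin [:: i; j; k]].
  by move=> p; rewrite !inE; do 3!case: (p == _).
have rkij : [pred p | p \notin [:: k; i; j]] =i [pred p | p \notin [:: i; j; k]].
  by move=> p; rewrite !inE; do 3!case: (p == _).
rewrite !(eq_bigl _ _ rjki) !(eq_bigl _ _ rkij).
set Ski := \prod_(p in _) det3 (n k) (n i) _.
set Sij := \prod_(p in _) det3 (n i) (n j) _.
set Sjk := \prod_(p in _) det3 (n j) (n k) _.
have nz a b c : uniq [:: a; b; c] -> 
    \prod_(p in [pred p | p \notin [:: a; b; c]]) det3 (n a) (n b) (n p) != 0.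
  move=> uabc; apply/prodf_neq0=> p; rewrite !inE !negb_or => /and3P[pa pb _].
  apply: arc; move: uabc; rewrite /= !inE !negb_or => /and3P[/andP[ab _] _ _].
  by rewrite [a == p]eq_sym [b == p]eq_sym ab pa pb.
have Sij0 : Sij != 0 by apply: nz.
have Sjk0 : Sjk != 0 by rewrite /Sjk -(eq_bigl _ _ rjki) nz.
have Ski0 : Ski != 0 by rewrite /Ski -(eq_bigl _ _ rkij) nz.
move=> eh eg ef.
apply: (mulIf (mulf_neq0 (mulf_neq0 Ski0 Sij0) Sjk0)).
transitivity ((dot (n k) f * Ski) * (dot (n i) g * Sij) * (dot (n j) h * Sjk)).
  by ring.
by rewrite ef eg eh; ring.
Qed.

Lemma distinct_exists (A : {set I}) : (#|A| < #|I|)%N -> exists j, j \notin A.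
Proof.
move=> ltA; have /subsetPn[j _ jA] : ~~ ([set: I] \subset A).
  by apply/negP=> /subset_leq_card; rewrite cardsT leqNgt ltA.
by exists j.
Qed.

Lemma triple_exists (i : I) : exists j k, uniq [:: i; j; k].
Proof.
have cI : (3 < #|I|)%N.
  have := finNzRing_gt1 F; move: oddF; rewrite cardI ltnS.
  by case: #|F| => [|[|[|]]].
have [|j] := distinct_exists (A := [set i]); first by rewrite cards1 (ltn_trans _ cI).
rewrite inE => ji; have [|k] := distinct_exists (A := [set i; j]).
  by rewrite (leq_ltn_trans _ cI) // cards2; case: (_ != _).
rewrite !inE negb_or => /andP[ki kj]; exists j, k.
by rewrite /= !inE !negb_or (eq_sym i j) (eq_sym i k) (eq_sym j k) ji ki kj.
Qed.

(** Fix a point e and rescale the tangent form of every other point i so that its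
    value at e is the value at i of the tangent form of e.  The lemma of tangents
    for the triple e, i, j then gives the symmetry for the pair i, j. *)
Lemma symmetric_tangent_forms (e : I) :
  exists2 g : I -> 'rV[F]_3, forall i, tangent_form i (g i) &
    forall i j, dot (n j) (g i) = dot (n i) (g j).
Proof.
have /fin_all_exists[f fP] i : exists f, tangent_form i f.
  by have [j [k uijk]] := triple_exists i; apply: tangent_form_exists_at uijk.
pose s i := if i == e then 1 else dot (n i) (f e) / dot (n e) (f i).
have fe i : i != e -> dot (n e) (f i) != 0.
  by move=> ie; apply: (fP i).2; rewrite eq_sym.
have s_neq0 i : s i != 0.
  rewrite /s; have [_|ie] := eqVneq i e; first exact: oner_neq0.
  by rewrite mulf_neq0 ?invr_eq0 ?fe // (fP e).2.
exists (fun i => s i *: f i) => [i|].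
  split=> [|j ji]; first by rewrite dotZr (fP i).1 mulr0.
  by rewrite dotZr mulf_neq0 // (fP i).2.
have sym_e i : dot (n i) (s e *: f e) = dot (n e) (s i *: f i).
  rewrite !dotZr /s eqxx mul1r; case: eqVneq => [->|ie]; first by rewrite mul1r.
  by rewrite divfK ?fe.
move=> i j; have [->|ie] := eqVneq i e; first exact: sym_e.
have [->|je] := eqVneq j e; first by rewrite sym_e.
have [->//|ij] := eqVneq i j.
have ueij : uniq [:: e; i; j].
  by rewrite /= !inE !negb_or !(eq_sym e) ie je ij.
have := lemma_of_tangents ueij (fP e) (fP i) (fP j).
rewrite !dotZr /s (negPf ie) (negPf je) => eq3.
apply: (mulIf (mulf_neq0 (fe i ie) (fe j je))).
transitivity (dot (n i) (f e) * dot (n j) (f i) * dot (n e) (f j)).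
  by field; rewrite fe.
by rewrite -eq3; field; rewrite fe.
Qed.

(** The matrix A that sends every point of the arc to its tangent form, scaled
    symmetrically, is itself symmetric; its form vanishes on the arc because each
    point lies on its own tangent.  This is Segre's theorem. *)
Lemma segre : exists A : 'M[F]_3,
  [/\ A^T = A, A \in unitmx & forall i, dot (n i *m A) (n i) = 0].
Proof.
have /card_gt0P[a _] : (0 < #|I|)%N by rewrite cardI.
have [b [c uabc]] := triple_exists a.
have [g gt gsym] := symmetric_tangent_forms a.
pose M := rows3 (n a) (n b) (n c); pose G := rows3 (g a) (g b) (g c).
have unitM : M \in unitmx by rewrite unitmxE unitfE; apply: arc.
have unitMt : M^T \in unitmx by rewrite unitmx_tr.
pose A := G^T *m invmx M^T.
(* By symmetry, the values of the form g i at the three basis points a, b, c are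
   the values of g a, g b, g c at the point i, hence linear in the point. *)
have nA i : n i *m A = g i.
  have e : n i *m G^T = g i *m M^T.
    by rewrite !mul_rows3_tr !(gsym _ i) !(dotC (g i)).
  by rewrite /A mulmxA e mulmxK.
have MA : M *m A = G.
  by apply/row_matrixP=> i; rewrite row_mul !row_rows3; elim/ord3P: i; rewrite nA.
have AE : A = invmx M *m G by rewrite -MA mulKmx.
have AT : A^T = A by rewrite [RHS]AE /A trmx_mul trmxK trmx_inv trmxK.
exists A; split=> // [|i]; last by rewrite nA dotC (gt i).1.
rewrite AE unitmx_mul unitmx_inv unitM /=.
suff : G *m M^T \in unitmx by rewrite unitmx_mul => /andP[].
pose x := dot (g a) (n b); pose y := dot (g a) (n c); pose z := dot (g b) (n c).
(* The Gram matrix on the basis has zero diagonal and nonzero entries elsewhere,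
   so its determinant 2xyz does not vanish. *)
have -> : G *m M^T = rows3 (vec3 0 x y) (vec3 x 0 z) (vec3 y z 0).
  apply/row_matrixP=> i; rewrite row_mul !row_rows3.
  have gg u v : dot (g u) (n v) = dot (g v) (n u) by rewrite !(dotC (g _)) gsym.
  have g0 u : dot (g u) (n u) = 0 by rewrite dotC (gt u).1.
  elim/ord3P: i => /=; rewrite mul_rows3_tr g0 /x /y /z //.
  - by rewrite (gg b a).
  - by rewrite (gg c a) (gg c b).
have -> : (rows3 (vec3 0 x y) (vec3 x 0 z) (vec3 y z 0) \in unitmx) =
    (2 * x * y * z != 0).
  rewrite unitmxE unitfE -/(det3 _ _ _) det3E /vec3 !mxE /=.
  by congr (_ != 0); ring.
have off u v : u != v -> dot (g u) (n v) != 0.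
  by move=> uv; rewrite dotC (gt u).2 // eq_sym.
move: uabc; rewrite /= !inE !negb_or !andbT => /andP[/andP[ab ac] bc].
by rewrite !mulf_neq0 ?off // odd_card_two_neq0.
Qed.

End Segre.

(** * The model set *)

Definition disc (F : fieldType) (v : 'rV[F]_3) : F :=
  v 0 1 ^+ 2 - 4 * v 0 0 * v 0 2.

(** The quadratic form of v is not a product of two independent linear forms
    over F. *)
Definition no_two_roots (F : fieldType) (v : 'rV[F]_3) : Prop :=
  ~ exists2 d, d != 0 & d ^+ 2 = disc v.

Lemma no_two_roots_scale (F : fieldType) :
  scale_inv (@no_two_roots F).
Proof.
move=> a v a_neq0.
have eD : disc (a *: v) = a ^+ 2 * disc v by rewrite /disc !mxE; ring.
split=> nr [d d_neq0 ed]; apply: nr.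
  by exists (a * d); rewrite ?mulf_neq0 // exprMn ed eD.
exists (d / a); first by rewrite mulf_neq0 ?invr_eq0.
by rewrite exprMn ed eD; field.
Qed.

(** * The Ballico-Hefez curve *)

Lemma vline_scale (K : fieldType) (V : vectType K) (a : K) (v : V) :
  a != 0 -> (<[a *: v]> = <[v]>)%VS.
Proof.
move=> a_neq0; apply/eqP; rewrite eqEdim -memvE memvZ ?memv_line //=.
by rewrite !dim_vline scaler_eq0 (negPf a_neq0).
Qed.

Section Frobenius.
Variables (F : finFieldType) (K : closedFieldType) (iota : {rmorphism F -> K}).
Local Notation q := #|F|.

Lemma frobenius_add (x y : K) : (x + y) ^+ q = x ^+ q + y ^+ q.
Proof.
have [p p_pr pF] := finPcharP F; apply: exprDn_pchar.
rewrite [q](card_pprimeChar pF) pnatX; apply/orP; left.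
by rewrite pnatE // (rmorph_pchar iota).
Qed.

Lemma frobenius_fixed (x : F) : iota x ^+ q = iota x.
Proof. by rewrite -rmorphXn expf_card. Qed.

Lemma frobenius_fixedP (u : K) : u ^+ q = u -> exists x, u = iota x.
Proof.
move=> uq; have /(congr1 (horner^~ u \o map_poly iota)) /= := finField_genPoly F.
rewrite rmorphB /= map_polyXn map_polyX !hornerE uq subrr.
rewrite rmorph_prod horner_prod => /esym/eqP/prodf_eq0[x _].
by rewrite rmorphB /= map_polyX map_polyC !hornerE subr_eq0 => /eqP; exists x.
Qed.

(** Frobenius permutes the roots u and b - u, so it either exchanges them or fixes
    u. *)
Lemma conjugate_root (b c : F) (u : K) :
    u ^+ 2 = iota b * u - iota c ->
  u ^+ q + u = iota b \/ exists x, u = iota x.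
Proof.
move=> uroot; have uqroot : (u ^+ q) ^+ 2 = iota b * u ^+ q - iota c.
  have := frobenius_add (u ^+ 2) (iota c); rewrite {1}uroot subrK exprMn.
  rewrite !frobenius_fixed => ->; rewrite exprAC; ring.
have /eqP : (u ^+ q - u) * (u ^+ q + u - iota b) = 0.
  transitivity ((u ^+ q) ^+ 2 - u ^+ 2 - iota b * (u ^+ q - u)); first by ring.
  by rewrite uqroot uroot; ring.
rewrite mulf_eq0 !subr_eq0 => /orP[/eqP/frobenius_fixedP|/eqP]; by [right|left].
Qed.

Lemma quadratic_root (b c : K) : exists u, u ^+ 2 = b * u - c.
Proof.
have [u] := @GRing.solve_monicpoly K 2 (nth 0 [:: - c; b]) (ltn0Sn 1).
by rewrite !big_ord_recl big_ord0 /= => uroot; exists u; rewrite uroot; ring.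
Qed.

Hypothesis oddF : odd q.

Lemma ballico_hefez_param (P : point F 2) (s t a : K) :
    (s, t) != (0, 0) -> map_mx iota (coords P) = a *: Phi q s t ->
  rational_points iota (ballico_hefez (K:=K) q) P.
Proof.
move=> st eP; have nz : map_mx iota (coords P) != 0 by rewrite map_mx_eq0 coords_neq0.
have [P' eP'] := point_exists nz; exists P' => //; exists s, t; split=> //.
rewrite eP' eP vline_scale //; apply: contraNneq nz => a0.
by rewrite eP a0 scale0r.
Qed.

(** If iota v = a * Phi (s, t), the discriminant of v is the square of
    r = a (s^q t - s t^q).  When r lies in F so does s / t, and then r = 0.
    Conversely Frobenius exchanges the two roots (1 : - u) and (1 : - u') of the
    form of v, unless u lies in F, and in that case it is a double root. *)
Lemma ballico_hefez_modelled :
  modelled (@no_two_roots F) (rational_points iota (ballico_hefez (K:=K) q)) 1%:M.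
Proof.
split=> [|P]; first exact: unitmx1.
rewrite mulmx1; set v := coords P.
have v_neq0 : v != 0 := coords_neq0 P.
split=> [[P' [s [t [_ ePhi]]] eP] [d d_neq0 ed]|nr].
  have /vlineP[a eV] : map_mx iota v \in <[Phi q s t]>%VS.
    by rewrite -ePhi eP memv_line.
  have e0 : iota (v 0 0) = a * (s ^+ q * s).
    by have := congr1 (fun m : 'rV_3 => m 0 0) eV; rewrite !mxE /= exprSr.
  have e1 : iota (v 0 1) = a * (s ^+ q * t + s * t ^+ q).
    by have := congr1 (fun m : 'rV_3 => m 0 1) eV; rewrite !mxE /=.
  have e2 : iota (v 0 2) = a * (t ^+ q * t).
    by have := congr1 (fun m : 'rV_3 => m 0 2) eV; rewrite !mxE /= exprSr.
  (* Suppose disc v = d^2 with d != 0; then r is d or - d. *)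
  pose r := a * (s ^+ q * t - s * t ^+ q).
  have [d' d'_neq0 ed'] : exists2 d', d' != 0 & iota d' = r.
    have /eqP : iota d ^+ 2 = r ^+ 2.
      by rewrite -rmorphXn ed /disc rmorphB rmorphXn !rmorphM rmorph_nat e0 e1 e2 /r; ring.
    rewrite eqf_sqr => /orP[/eqP|/eqP] eqd; first by exists d.
    by exists (- d); rewrite ?oppr_eq0 // rmorphN eqd opprK.
  have r_neq0 : r != 0 by rewrite -ed' fmorph_eq0.
  have a_neq0 : a != 0 by apply: contraNneq r_neq0 => a0; rewrite /r a0 mul0r.
  have q_gt0 : (0 < q)%N by apply: ltnW; apply: finNzRing_gt1.
  have t_neq0 : t != 0.
    by apply: contraNneq r_neq0 => t0; rewrite /r t0 expr0n gtn_eqF // !mulr0 subrr mulr0.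
  have two0 : (2 : K) != 0.
    by rewrite -(rmorph_nat iota) fmorph_eq0 odd_card_two_neq0.
  have v2 : iota (v 0 2) != 0 by rewrite e2 !mulf_neq0 ?expf_neq0.
  have es : s = iota ((v 0 1 - d') / (2 * v 0 2)) * t.
    rewrite fmorph_div rmorphB rmorphM rmorph_nat e1 ed' e2 /r.
    by field; rewrite a_neq0 t_neq0 two0 expf_neq0.
  case/eqP: r_neq0; rewrite /r es exprMn frobenius_fixed; ring.
(* When the last coordinate vanishes the form has a root at infinity, which must
   be double. *)
have [v2|v2] := eqVneq (v 0 2) 0.
  have v1 : v 0 1 = 0.
    apply/eqP/negP=> /negP v1; apply: nr; exists (v 0 1) => //.
    by rewrite /disc v2 mulr0 subr0.
  apply: (@ballico_hefez_param P 1 0 (iota (v 0 0))).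
    by rewrite xpair_eqE oner_eq0.
  have q_gt0 : (0 < q)%N by apply: ltnW; apply: finNzRing_gt1.
  apply: rV3P; rewrite !mxE /= ?v1 ?v2 ?rmorph0.
  - by rewrite expr1n mulr1.
  - by rewrite expr0n gtn_eqF // !mulr0 addr0 mulr0.
  - by rewrite expr0n mulr0.
pose b := v 0 1 / v 0 2; pose c := v 0 0 / v 0 2.
have [u uroot] := quadratic_root (iota b) (iota c).
have usum : u ^+ q + u = iota b.
  have [//|[x ux]] := conjugate_root uroot.
  have xroot : x ^+ 2 = b * x - c.
    by apply: (fmorph_inj iota); rewrite rmorphXn rmorphB rmorphM /= -ux.
  have : 2 * v 0 2 * x - v 0 1 = 0.
    apply/eqP/negP=> /negP d_neq0; apply: nr; exists (2 * v 0 2 * x - v 0 1) => //.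
    transitivity (4 * v 0 2 ^+ 2 * x ^+ 2 - 4 * v 0 2 * v 0 1 * x + v 0 1 ^+ 2).
      by ring.
    by rewrite xroot /disc /b /c; field.
  move/subr0_eq=> e1; rewrite ux frobenius_fixed -rmorphD; congr (iota _).
  by rewrite /b -e1; field.
have uprod : u ^+ q * u = iota c.
  rewrite -[u ^+ q](addrK u) usum mulrBl -expr2 uroot; ring.
apply: (@ballico_hefez_param P u 1 (iota (v 0 2))).
  by rewrite xpair_eqE oner_eq0 andbF.
apply: rV3P; rewrite !mxE /=.
- by rewrite exprSr uprod -rmorphM /c mulrC divfK.
- by rewrite expr1n !mulr1 usum -rmorphM /b mulrC divfK.
- by rewrite expr1n mulr1.
Qed.

End Frobenius.

(** * Complements of arcs of lines *)

(** The projective line over F is encoded as [option F], with [None] at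
    infinity. *)
Definition line_root (F : fieldType) (v : 'rV[F]_3) (o : option F) : bool :=
  if o is Some t then v 0 0 + v 0 1 * t + v 0 2 * t ^+ 2 == 0 else v 0 2 == 0.

(** For two finite roots t, t' the discriminant is the square of v_2 (t - t'); for
    a root at infinity it is the square of v_1. *)
Lemma two_line_roots (F : fieldType) (v : 'rV[F]_3) : (2 : F) != 0 -> v != 0 ->
  (exists o o', [/\ o != o', line_root v o & line_root v o']) <->
  exists2 d, d != 0 & d ^+ 2 = disc v.
Proof.
move=> two_neq0 v_neq0; rewrite /disc; split.
  have inf t : line_root v None -> line_root v (Some t) ->
      exists2 d, d != 0 & d ^+ 2 = v 0 1 ^+ 2 - 4 * v 0 0 * v 0 2.
    move=> /eqP/= v2 /eqP; rewrite /= v2 mul0r addr0 => v0.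
    exists (v 0 1); last by ring.
    apply: contraNneq v_neq0 => v1; apply/eqP/rV3P; rewrite ?v1 ?v2 mxE //.
    by move: v0; rewrite v1 mul0r addr0.
  case=> -[t|] [[t'|] [// oo' r r']]; [|exact: inf r' r|exact: inf r r'].
  have tt' : t - t' != 0 by rewrite subr_eq0; apply: contraNneq oo' => ->.
  move: r r' => /= /eqP r /eqP r'.
  have v1 : v 0 1 = - v 0 2 * (t + t').
    apply: (mulfI tt'); apply/eqP; rewrite -subr_eq0 -[X in _ == X](subrr 0).
    by rewrite -{1}r -r'; apply/eqP; ring.
  have v0 : v 0 0 = v 0 2 * t * t'.
    by apply/eqP; rewrite -subr_eq0 -r v1; apply/eqP; ring.
  exists (v 0 2 * (t - t')); last by rewrite v0 v1; ring.
  rewrite mulf_neq0 //; apply: contraNneq v_neq0 => v2.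
  by apply/eqP/rV3P; rewrite ?v0 ?v1 ?v2 mxE ?oppr0 ?mul0r.
case=> d d_neq0 ed; have [v2|v2] := eqVneq (v 0 2) 0.
  have v1 : v 0 1 != 0.
    apply: contraNneq d_neq0 => v1; rewrite -sqrf_eq0 ed v1 v2; apply/eqP; ring.
  exists None, (Some (- v 0 0 / v 0 1)); split=> //=; first by rewrite v2.
  by rewrite v2; apply/eqP; field.
pose root (s : F) := (- v 0 1 + s * d) / (2 * v 0 2).
have rootP s : s ^+ 2 = 1 -> line_root v (Some (root s)).
  move=> s1; apply/eqP.
  transitivity ((s ^+ 2 * d ^+ 2 - (v 0 1 ^+ 2 - 4 * v 0 0 * v 0 2)) / (2 * (2 * v 0 2))).
    by rewrite /root; field; rewrite two_neq0 v2.
  by rewrite s1 ed mul1r subrr mul0r.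
exists (Some (root 1)), (Some (root (- 1))); split.
- apply: contraNneq d_neq0 => -[] /eqP; rewrite -subr_eq0 => e.
  have -> : d = (root 1 - root (-1)) * v 0 2.
    by rewrite /root; field; rewrite two_neq0 v2.
  by rewrite (eqP e) mul0r.
- by apply: rootP; rewrite expr1n.
- by apply: rootP; rewrite sqrrN expr1n.
Qed.

Section ArcOfLines.
Variable F : finFieldType.
Hypothesis oddF : odd #|F|.
Let two_neq0 : (2 : F) != 0 := odd_card_two_neq0 oddF.

(** The parameter t of the point (1 : t : t^2) of y^2 = xz, infinite at
    (0 : 0 : 1). *)
Definition conic_param (m : 'rV[F]_3) : option F :=
  if m 0 0 == 0 then None else Some (m 0 1 / m 0 0).

Lemma conic_paramP (m v : 'rV[F]_3) : m != 0 -> m 0 1 ^+ 2 = m 0 0 * m 0 2 ->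
  (dot v m == 0) = line_root v (conic_param m).
Proof.
move=> m_neq0 em; rewrite dotE /conic_param; have [m0|m0] := eqVneq (m 0 0) 0 => /=.
  have m1 : m 0 1 = 0 by apply/eqP; rewrite -sqrf_eq0 em m0 mul0r.
  rewrite m0 m1 !mulr0 !add0r mulf_eq0 orbC; have [m2|//] := eqVneq (m 0 2) 0.
  by case/eqP: m_neq0; apply: rV3P; rewrite ?m0 ?m1 ?m2 mxE.
have -> : m 0 2 = m 0 1 ^+ 2 / m 0 0 by rewrite em mulrC mulKf.
rewrite (_ : _ + _ + _ =
  m 0 0 * (v 0 0 + v 0 1 * (m 0 1 / m 0 0) + v 0 2 * (m 0 1 / m 0 0) ^+ 2)).
  by rewrite mulf_eq0 (negPf m0).
by field.
Qed.

Variable l : 'I_#|F|.+1 -> line F 2.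
Hypothesis dual_arc_l : dual_arc l.

(** Once the normals lie on y^2 = xz, their parameters are distinct and there are
    q + 1 of them, so every element of the projective line is the parameter of
    exactly one of the lines. *)
Lemma arc_complement_modelled :
  exists h, modelled (@no_two_roots F) (arc_complement l) h.
Proof.
have [linj lconc] := dual_arc_l.
have /fin_all_exists2[n n_neq0 nP] i := line_normal (l i).
have arc i j k : uniq [:: i; j; k] -> det3 (n i) (n j) (n k) != 0.
  move=> uijk; apply/eqP => /det3_eq0[c c_neq0 [ci cj ck]].
  have [P eP] := point_exists c_neq0.
  have [a _ ea] := coords_line c_neq0 eP.
  case: (lconc i j k uijk); exists P.
  by split; rewrite on_line_coords nP ea dotZl ?ci ?cj ?ck mulr0.
have [|A [symA unitA nA]] := segre oddF _ arc; first by rewrite card_ord.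
have [g unitg [k k_neq0 gk]] :=
  quadratic_normal_form oddF (oner_neq0 F) symA unitA.
pose m i := n i *m invmx g.
have mg i : m i *m g = n i by rewrite mulmxKV.
have m_neq0 i : m i != 0.
  by apply: contraNneq (n_neq0 i) => m0; rewrite -mg m0 mul0mx.
have mP i : m i 0 1 ^+ 2 = m i 0 0 * m i 0 2.
  have /eqP := gk (m i); rewrite mg nA eq_sym mulf_eq0 (negPf k_neq0) /=.
  by rewrite mul1r subr_eq0 => /eqP.
have incid i w : (w \in val (l i)) = line_root (w *m g^T) (conic_param (m i)).
  by rewrite nP -conic_paramP // dot_mulmxl trmxK mg.
have unitgt : g^T \in unitmx by rewrite unitmx_tr.
have cinj : injective (conic_param \o m).
  move=> i j /= eij; apply/linj/val_inj/vspaceP=> w.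
  by rewrite !incid eij.
have [pre _ preK] : bijective (conic_param \o m).
  by apply: inj_card_bij cinj _; rewrite card_option card_ord.
exists g^T; split=> // P; rewrite /arc_complement /no_two_roots.
have v_neq0 : coords P *m g^T != 0.
  apply: contraNneq (coords_neq0 P) => e.
  by rewrite -[coords P](mulmxK unitgt) e mul0mx.
rewrite -(two_line_roots two_neq0 v_neq0); split=> noP; last first.
  case=> i [j [ij Pi Pj]]; apply: noP.
  exists (conic_param (m i)), (conic_param (m j)).
  rewrite -!incid -!on_line_coords Pi Pj; split=> //.
  by apply: contraTneq ij => /cinj->; rewrite ltnn.
case=> o [o' [oo' ro ro']]; apply: noP.
have onP x : line_root (coords P *m g^T) x -> on_line P (l (pre x)).
  by rewrite on_line_coords incid -/((conic_param \o m) _) preK.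
have : pre o != pre o'.
  by apply: contra_neq oo' => /(congr1 (conic_param \o m)); rewrite !preK.
rewrite -val_eqE neq_ltn => /orP[lt|lt].
  by exists (pre o), (pre o'); split=> //; apply: onP.
by exists (pre o'), (pre o); split=> //; apply: onP.
Qed.

End ArcOfLines.

(** * Conics *)

Section QuadraticPolynomials.
Variable n : nat.

Definition quad_poly (R : comNzRingType) (A : 'M[R]_n) : {mpoly R[n]} :=
  \sum_i \sum_j (A i j)%:MP * 'X_i * 'X_j.

Lemma quad_polyD (R : comNzRingType) (A B : 'M[R]_n) :
  quad_poly (A + B) = quad_poly A + quad_poly B.
Proof.
rewrite /quad_poly -big_split; apply: eq_bigr => i _; rewrite -big_split.
by apply: eq_bigr => j _; rewrite mxE mpolyCD !mulrDl.
Qed.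

Lemma quad_polyZ (R : comNzRingType) (a : R) (A : 'M[R]_n) :
  quad_poly (a *: A) = a *: quad_poly A.
Proof.
rewrite /quad_poly scaler_sumr; apply: eq_bigr => i _; rewrite scaler_sumr.
by apply: eq_bigr => j _; rewrite mxE mpolyCM -mul_mpolyC !mulrA.
Qed.

Lemma quad_poly_delta (R : comNzRingType) (i j : 'I_n) :
  quad_poly (delta_mx i j) = 'X_i * 'X_j :> {mpoly R[n]}.
Proof.
rewrite /quad_poly (bigD1 i) //= (bigD1 j) //= !big1 ?addr0.
- by rewrite mxE !eqxx mpolyC1 mul1r.
- by move=> k ki; rewrite big1 // => k' _; rewrite mxE (negPf ki) mpolyC0 !mul0r.
- by move=> k kj; rewrite mxE (negPf kj) andbF mpolyC0 !mul0r.
Qed.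

Lemma quad_poly_tr (R : comNzRingType) (A : 'M[R]_n) :
  quad_poly A^T = quad_poly A.
Proof.
rewrite /quad_poly exchange_big; apply: eq_bigr => i _; apply: eq_bigr => j _.
by rewrite mxE mulrAC.
Qed.

(** Every monomial of degree 2 is a product of two variables; the matrix so
    obtained is made symmetric by averaging it with its transpose. *)
Lemma dhomog2_quad_poly (F : fieldType) (Q : {mpoly F[n]}) : (2 : F) != 0 ->
  Q \is 2.-homog -> exists2 A : 'M[F]_n, A^T = A & Q = quad_poly A.
Proof.
move=> two_neq0 homQ; suff [A ->] : exists A : 'M[F]_n, Q = quad_poly A.
  exists (2^-1 *: (A + A^T)).
    by rewrite linearZ linearD /= trmxK addrC.
  rewrite quad_polyZ quad_polyD quad_poly_tr -mulr2n -scaler_nat scalerA.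
  by rewrite mulVf // scale1r.
rewrite [Q]mpolyE big_seq; elim/big_ind: _ => [|p1 p2 [A1 ->] [A2 ->]|m mQ].
- by exists 0; rewrite -[0 in RHS](scale0r 0) quad_polyZ scale0r.
- by exists (A1 + A2); rewrite quad_polyD.
have /dhomogP/(_ m mQ)/= m2 := homQ.
have [i mi] : exists i, (0 < m i)%N.
  apply/existsP; apply: contraTT (ltn0Sn 1) => /existsPn all0.
  rewrite -leqNgt -m2 mdegE big1 // => i _.
  by have := all0 i; rewrite lt0n negbK => /eqP.
have em : m = (U_(i) + (m - U_(i)))%MM.
  by rewrite addmC submK // lep1mP -lt0n.
have /mdeg1P[j /eqP ej] : mdeg (m - U_(i)) == 1%N.
  by rewrite -(eqn_add2l 1) -[X in (X + _ == _)%N](mdeg1 i) -mdegD -em m2.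
by exists (Q@_m *: delta_mx i j); rewrite quad_polyZ quad_poly_delta em ej mpolyXD.
Qed.

Lemma map_quad_poly (F K : fieldType) (iota : {rmorphism F -> K})
    (A : 'M[F]_n) : map_mpoly iota (quad_poly A) = quad_poly (map_mx iota A).
Proof.
rewrite /quad_poly rmorph_sum; apply: eq_bigr => i _.
rewrite rmorph_sum; apply: eq_bigr => j _.
by rewrite !rmorphM /= map_mpolyC !map_mpolyX mxE.
Qed.

Lemma mderivXU (R : nzRingType) (i j : 'I_n) :
  ('X_j)^`M(i) = (j == i)%:R :> {mpoly R[n]}.
Proof.
rewrite mderivX mnm1E; case: eqP => [->|_]; last by rewrite scale0r.
rewrite scale1r (_ : _ - _ = 0)%MM ?mpolyX0 //.
by apply/mnmP=> k; rewrite mnmBE subnn mnm0E.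
Qed.

Lemma meval_quad_poly (F : fieldType) (A : 'M[F]_n) (v : 'rV[F]_n) :
  (quad_poly A).@[v 0] = (v *m A *m v^T) 0 0.
Proof.
rewrite /quad_poly raddf_sum /= mxE.
rewrite (eq_bigr (fun i => \sum_j A i j * v 0 i * v 0 j)) => [|i _].
  rewrite exchange_big; apply: eq_bigr => j _; rewrite !mxE mulr_suml.
  by apply: eq_bigr => i _; rewrite [v 0 i * _]mulrC.
rewrite raddf_sum; apply: eq_bigr => j _.
by rewrite /= !mevalM mevalC !mevalXU.
Qed.

Lemma mderiv_quad_poly (F : fieldType) (A : 'M[F]_n) k : A^T = A ->
  (quad_poly A)^`M(k) = (\sum_j (A k j)%:MP * 'X_j) *+ 2.
Proof.
move=> symA; rewrite /quad_poly !raddf_sum /=.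
have e i : (\sum_j (A i j)%:MP * 'X_i * 'X_j)^`M(k) =
    (i == k)%:R * (\sum_j (A k j)%:MP * 'X_j) + (A k i)%:MP * 'X_i :> {mpoly F[n]}.
  rewrite raddf_sum /= (eq_bigr (fun j => (i == k)%:R * ((A k j)%:MP * 'X_j) +
    (j == k)%:R * ((A i j)%:MP * 'X_i))) => [|j _]; last first.
    rewrite !mderivM mderivC !mderivXU mul0r add0r.
    have [->|_] := eqVneq i k; last by rewrite !mul0r mulr0 mul0r !add0r mulrC.
    by rewrite mulr1 mul1r; congr (_ + _); rewrite mulrC.
  rewrite big_split /= -mulr_sumr; congr (_ + _).
  rewrite (bigD1 k) //= eqxx mul1r big1 ?addr0 => [|j /negPf->]; last by rewrite mul0r.
  by rewrite -[in RHS]symA mxE.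
rewrite (eq_bigr _ (fun i _ => e i)) big_split /= -mulr_suml.
rewrite (bigD1 k) //= eqxx big1 ?addr0 => [|j /negPf->] //.
by rewrite mul1r mulr2n.
Qed.

End QuadraticPolynomials.

Section BinaryForms.
Variables (K : closedFieldType) (n : nat).
Implicit Types p q : {mpoly K[n]}.

Lemma unit_meval0 p : p.@[fun=> 0] = 0 -> p \isn't a GRing.unit.
Proof.
move=> p0; apply: contraTN isT => /(rmorph_unit (meval (fun=> 0))).
by rewrite /= p0 unitr0.
Qed.

(** The factors come from the roots u and - b / a - u of the dehomogenized
    form. *)
Lemma binary_form_splits (a b c : K) p q : exists x y z t : K,
  a%:MP * p * p + b%:MP * p * q + c%:MP * q * q =
  (x%:MP * p + y%:MP * q) * (z%:MP * p + t%:MP * q).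
Proof.
have [->|a_neq0] := eqVneq a 0.
  by exists 0, 1, b, c; rewrite !mpolyC0 !mpolyC1; ring.
have [u uroot] := quadratic_root (- b / a) (c / a).
pose u' := - b / a - u.
have -> : b = - a * (u + u') by rewrite /u'; field.
have -> : c = a * u * u'.
  by rewrite /u' mulrBr -!mulrA -[u * u]expr2 uroot; field; exact: a_neq0.
exists a, (- a * u), 1, (- u').
rewrite !(mpolyCN, mpolyCM, mpolyCD) mpolyC1; ring.
Qed.

End BinaryForms.

(** A kernel vector e with e_i != 0 makes the form invariant under translation by
    multiples of e, so X_j may be replaced by L_j = X_j - (e_j / e_i) X_i.  As
    L_i = 0, a binary form in the other two L_j remains. *)
Lemma singular_quad_poly_reducible (K : closedFieldType) (A : 'M[K]_3) (e : 'rV[K]_3) :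
  A^T = A -> e != 0 -> e *m A = 0 -> ~ irreducible_mpoly (quad_poly A).
Proof.
move=> symA e_neq0 eA [_ _ irr].
have [i ei] : exists i, e 0 i != 0 by apply/rV0Pn.
pose L j : {mpoly K[3]} := 'X_j - (e 0 j / e 0 i)%:MP * 'X_i.
have Li : L i = 0 by rewrite /L divff // mpolyC1 mul1r subrr.
have L0 j : (L j).@[fun=> 0] = 0.
  by rewrite /L mevalB mevalM !mevalXU mulr0 subrr.
have sumL j : \sum_k (A j k)%:MP * L k = \sum_k (A j k)%:MP * 'X_k.
  apply/eqP; rewrite -subr_eq0 -sumrB.
  under eq_bigr => k _.
    rewrite (_ : _ - _ = - ((e 0 k * A k j) / e 0 i)%:MP * 'X_i); last first.
      have -> : A k j = A j k by rewrite -[in LHS]symA mxE.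
      by rewrite /L !mpolyCM; ring.
    over.
  rewrite -mulr_suml sumrN -raddf_sum -mulr_suml /=.
  have := congr1 (fun m : 'rV_3 => m 0 j) eA; rewrite !mxE => ->.
  by rewrite mul0r mpolyC0 oppr0 mul0r.
have AL : quad_poly A = \sum_j \sum_k (A j k)%:MP * L j * L k.
  rewrite /quad_poly.
  transitivity (\sum_j 'X_j * \sum_k (A j k)%:MP * L k : {mpoly K[3]}).
    apply: eq_bigr => j _; rewrite sumL mulr_sumr.
    by apply: eq_bigr => k _; rewrite mulrA [_ * 'X_j]mulrC.
  rewrite (eq_bigr (fun j => \sum_k (A k j)%:MP * 'X_j * L k)); last first.
    move=> j _; rewrite mulr_sumr; apply: eq_bigr => k _.
    have -> : A k j = A j k by rewrite -[in LHS]symA mxE.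
    by rewrite mulrA ['X_j * _]mulrC.
  rewrite exchange_big; apply: eq_bigr => k _.
  by rewrite -mulr_suml -sumL mulr_suml; apply: eq_bigr => j _; ring.
have splits (p q : {mpoly K[3]}) (a b c : K) : p.@[fun=> 0] = 0 -> q.@[fun=> 0] = 0 ->
    quad_poly A <> a%:MP * p * p + b%:MP * p * q + c%:MP * q * q.
  move=> p0 q0; have [x [y [z [t ->]]]] := binary_form_splits a b c p q.
  have nu x' y' : x'%:MP * p + y'%:MP * q \isn't a GRing.unit.
    by apply: unit_meval0; rewrite mevalD !mevalM p0 q0 !mulr0 addr0.
  by case/irr; apply/negP; apply: nu.
have symE j k : A j k = A k j by rewrite -[in LHS]symA mxE.
rewrite !sum_ord3 in AL.
have : [\/ i = 0, i = 1 | i = 2].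
  by elim/ord3P: (i); [constructor 1|constructor 2|constructor 3].
case=> ei'; rewrite ei' in Li; rewrite Li in AL.
- apply: (splits _ _ (A 1 1) (A 1 2 + A 1 2) (A 2 2) (L0 1) (L0 2)).
  by rewrite AL (symE 2 1) mpolyCD; ring.
- apply: (splits _ _ (A 0 0) (A 0 2 + A 0 2) (A 2 2) (L0 0) (L0 2)).
  by rewrite AL (symE 2 0) mpolyCD; ring.
- apply: (splits _ _ (A 0 0) (A 0 1 + A 0 1) (A 1 1) (L0 0) (L0 1)).
  by rewrite AL (symE 1 0) mpolyCD; ring.
Qed.

Lemma conic_gram (F : fieldType) (K : closedFieldType)
    (iota : {rmorphism F -> K}) (Q : {mpoly F[3]}) :
    (2 : F) != 0 -> conic iota Q ->
  exists A : 'M[F]_3, [/\ A^T = A, A \in unitmx & Q = quad_poly A].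
Proof.
move=> two_neq0 [homQ irrQ]; have [A symA eQ] := dhomog2_quad_poly two_neq0 homQ.
exists A; split=> //; rewrite unitmxE unitfE; apply/negP=> /det0P[e e_neq0 eA].
apply: (@singular_quad_poly_reducible _ (map_mx iota A) (map_mx iota e)).
- by apply/matrixP=> i j; rewrite !mxE -[in LHS]symA mxE.
- by rewrite map_mx_eq0.
- by rewrite -map_mxM eA map_mx0.
- by rewrite -map_quad_poly -eQ.
Qed.

(** The conditions say that c lies on the tangent to y^2 = 4xz at r.  For r
    proportional to (1, t, t^2 / 4) the second one is the quadratic equation
    c_0 t^2 - 2 c_1 t + 4 c_2 = 0, whose reduced discriminant is disc c. *)
Lemma isotropic_tangency (F : fieldType) (c : 'rV[F]_3) : (2 : F) != 0 ->
  (exists2 r : 'rV[F]_3, r != 0 & r 0 1 ^+ 2 = 4 * r 0 0 * r 0 2 /\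
     r 0 1 * c 0 1 = 2 * (r 0 0 * c 0 2 + r 0 2 * c 0 0)) <->
  exists d, d ^+ 2 = disc c.
Proof.
move=> two_neq0; rewrite /disc; split.
  case=> r r_neq0 [er erc]; have [r0|r0] := eqVneq (r 0 0) 0.
    have r1 : r 0 1 = 0.
      by apply/eqP; rewrite -sqrf_eq0 er r0 mulr0 mul0r.
    have r2 : r 0 2 != 0.
      by apply: contraNneq r_neq0 => r2; apply/eqP/rV3P; rewrite ?r0 ?r1 ?r2 mxE.
    have c0 : c 0 0 = 0.
      apply/eqP; move/eqP: erc; rewrite r0 r1 !mul0r add0r eq_sym !mulf_eq0.
      by rewrite (negPf two_neq0) (negPf r2).
    by exists (c 0 1); rewrite c0; ring.
  exists (c 0 0 * r 0 1 / r 0 0 - c 0 1).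
  have e2 : r 0 2 = r 0 1 ^+ 2 / (2 * (2 * r 0 0)).
    by rewrite er; field; rewrite r0 two_neq0.
  have ec2 : c 0 2 = (r 0 1 * c 0 1 / 2 - r 0 2 * c 0 0) / r 0 0.
    by rewrite erc; field; rewrite r0 two_neq0.
  by rewrite ec2 e2; field; rewrite r0 two_neq0.
case=> d ed; have [c0|c0] := eqVneq (c 0 0) 0.
  exists (vec3 0 0 1).
    by apply/eqP=> /rowP/(_ 2)/eqP; rewrite !mxE /= oner_eq0.
  by rewrite !mxE /= c0; split; ring.
exists (vec3 1 ((c 0 1 + d) / c 0 0) (((c 0 1 + d) / c 0 0 / 2) ^+ 2)).
  by apply/eqP=> /rowP/(_ 0)/eqP; rewrite !mxE /= oner_eq0.
rewrite !mxE /=; split; first by field; rewrite c0 two_neq0.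
have ec2 : c 0 2 = (c 0 1 ^+ 2 - d ^+ 2) / (2 * (2 * c 0 0)).
  by rewrite ed; field; rewrite c0 two_neq0.
by rewrite ec2; field; rewrite c0 two_neq0.
Qed.

Section Conic.
Variables (F : finFieldType) (A : 'M[F]_3).
Hypothesis oddF : odd #|F|.
Let two_neq0 : (2 : F) != 0 := odd_card_two_neq0 oddF.
Hypotheses (symA : A^T = A) (unitA : A \in unitmx).
Local Notation Q := (quad_poly A).

Lemma on_conicE P : on_conic Q P <-> dot (coords P *m A) (coords P) = 0.
Proof. by rewrite /on_conic meval_quad_poly. Qed.

Lemma tangent_conicE (P : point F 2) (w : 'rV[F]_3) :
  \sum_(i < 3) Q^`M(i).@[coords P 0] * w 0 i = 2 * dot (coords P *m A) w.
Proof.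
rewrite /dot mxE mulr_sumr; apply: eq_bigr => i _.
rewrite mderiv_quad_poly // mevalMn !mxE -mulr_natl -mulrA; congr (_ * (_ * _)).
rewrite raddf_sum; apply: eq_bigr => j _ /=.
by rewrite mevalM mevalC mevalXU mulrC -[in LHS]symA mxE.
Qed.

(** A tangent through P is the polar of an isotropic vector r conjugate to the
    coordinates of P; the polar is a line because A is invertible. *)
Lemma tangent_through (P : point F 2) :
  (exists R l, tangent_at Q R l /\ on_line P l) <->
  exists2 r, r != 0 & dot (r *m A) r = 0 /\ dot (r *m A) (coords P) = 0.
Proof.
split=> [[R [l [[onR tanR] onP]]]|[r r_neq0 [rr rP]]].
  exists (coords R); first exact: coords_neq0.
  split; first exact/on_conicE.
  move: onP; rewrite on_line_coords => /tanR; rewrite tangent_conicE => /eqP.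
  by rewrite mulf_eq0 (negPf two_neq0) => /eqP.
have rA_neq0 : r *m A != 0.
  by apply: contraNneq r_neq0 => e; rewrite -[r](mulmxK unitA) e mul0mx.
have [R eR] := point_exists r_neq0; have [a a_neq0 ea] := coords_line r_neq0 eR.
have [l lP] := line_of_normal rA_neq0.
exists R, l; split; last by rewrite on_line_coords lP dotC rP.
split; first by apply/on_conicE; rewrite ea -scalemxAl dotZl dotZr rr !mulr0.
move=> w; rewrite tangent_conicE ea -scalemxAl dotZl lP dotC.
split=> [/eqP->|/eqP]; first by rewrite !mulr0.
by rewrite !mulf_eq0 (negPf two_neq0) (negPf a_neq0).
Qed.

(** In coordinates where the conic is y^2 = 4xz, the form Q(P) is the discriminant
    up to a constant, and P is on a tangent when the discriminant is a square. *)
Lemma conic_modelled :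
  exists h, modelled (@no_two_roots F) (internal_or_on Q) h.
Proof.
have four_neq0 : (4 : F) != 0.
  by rewrite (_ : 4 = 2 * 2 :> F) ?mulf_neq0 //; ring.
have [g unitg [k k_neq0 gk]] := quadratic_normal_form oddF four_neq0 symA unitA.
have polar u v : dot (u *m g *m A) (v *m g) =
    k * (u 0 1 * v 0 1 - 2 * (u 0 0 * v 0 2 + u 0 2 * v 0 0)).
  apply: (mulfI two_neq0).
  transitivity (dot ((u + v) *m g *m A) ((u + v) *m g)
    - dot (u *m g *m A) (u *m g) - dot (v *m g *m A) (v *m g)).
    rewrite !mulmxDl !dotDl !dotDr [dot (v *m g *m A) (u *m g)]dot_sym //; ring.
  by rewrite !gk !mxE; ring.
exists (invmx g); split=> [|P]; first by rewrite unitmx_inv.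
set v := coords P *m invmx g.
have vg : v *m g = coords P by rewrite mulmxKV.
have qP : dot (coords P *m A) (coords P) = k * disc v.
  by rewrite -vg gk /disc.
have onP : on_conic Q P <-> disc v = 0.
  rewrite on_conicE qP; split=> [/eqP|->]; last by rewrite mulr0.
  by rewrite mulf_eq0 (negPf k_neq0) => /eqP.
have tanP : (exists R l, tangent_at Q R l /\ on_line P l) <->
    exists d, d ^+ 2 = disc v.
  rewrite tangent_through -isotropic_tangency //.
  split=> -[r r_neq0 [rr rP]].
    have [s sg] : exists s, s *m g = r by exists (r *m invmx g); rewrite mulmxKV.
    exists s; first by apply: contraNneq r_neq0 => s0; rewrite -sg s0 mul0mx.
    move: rr rP; rewrite -sg -vg gk polar.
    move=> /eqP; rewrite mulf_eq0 (negPf k_neq0) subr_eq0 => /eqP-> /eqP.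
    by rewrite mulf_eq0 (negPf k_neq0) subr_eq0 => /eqP->.
  exists (r *m g).
    by apply: contraNneq r_neq0 => e; rewrite -[r](mulmxK unitg) e mul0mx.
  by rewrite gk -vg polar rr rP !subrr mulr0.
rewrite /internal_or_on /internal onP tanP /no_two_roots; split.
  case=> [[_ notan] [d _ ed]|d0 [d]]; first by apply: notan; exists d.
  by rewrite d0 => /negPf d_neq0 /eqP; rewrite sqrf_eq0 d_neq0.
move=> nr; have [d0|d_neq0] := eqVneq (disc v) 0; [by right|left].
split=> [d0|[d ed]]; first by rewrite d0 eqxx in d_neq0.
by apply: nr; exists d => //; rewrite -sqrf_eq0 ed.
Qed.

End Conic.

Theorem theorem3p3 (F : finFieldType) (q : nat) (hq : #|F| = q) (hodd : odd q)
    (K : closedFieldType) (iota : {rmorphism F -> K})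
    (hK : forall x : K, algebraicOver iota x)
    (l : 'I_q.+1 -> line F 2) (hl : dual_arc l)
    (Q : {mpoly F[3]}) (hQ : conic iota Q) :
  let BFq := rational_points iota (ballico_hefez (K:=K) q) in
  let S := arc_complement l in
  let T := internal_or_on Q in
  [/\ proj_equiv BFq S, proj_equiv S T & proj_equiv BFq T].
Proof.
subst q => BFq S T.
have modelB := ballico_hefez_modelled iota hodd.
have [hS modelS] := arc_complement_modelled hodd hl.
have [A [symA unitA eQ]] := conic_gram (odd_card_two_neq0 hodd) hQ.
have [hT] := conic_modelled hodd symA unitA.
rewrite -eQ => modelT; have winv := @no_two_roots_scale F.
by split; [exact: modelled_proj_equiv winv modelB modelS
          | exact: modelled_proj_equiv winv modelS modelT
          | exact: modelled_proj_equiv winv modelB modelT].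
Qed.
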